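(* There exists an absolute constant $c>0$ such that for every prime power $q$ the digraph $G_2$ is a $\left(|SL_2(\mathbb{F}_q)|\cdot|M_2(\mathbb{F}_q)|,\ |SL_2(\mathbb{F}_q)|,\ c\,q^{11/4}\right)$-digraph.
   Context: $\mathbb{F}_q$ is the finite field with $q$ elements, $M_2(\mathbb{F}_q)$ is the ring of $2\times 2$ matrices over $\mathbb{F}_q$, and $SL_2(\mathbb{F}_q)$ is the set of matrices in $M_2(\mathbb{F}_q)$ with determinant $1$. The digraph $G_2$ (sum-product digraph over $SL_2(\mathbb{F}_q)$) has vertex set $SL_2(\mathbb{F}_q)\times M_2(\mathbb{F}_q)$, with a directed edge from $(A,C)$ to $(B,D)$ if and only if $AB=C+D$. For a digraph $G$ on $n$ vertices in which every vertex has in-degree and out-degree $d$, with adjacency matrix $A_G$ having complex eigenvalues $\lambda_1=d,\lambda_2,\dots,\lambda_n$ (all with $|\lambda_i|\le d$), set $\lambda(G)=\max\{|\lambda_i|: |\lambda_i|\neq d\}$. $G$ is an $(n,d,\lambda)$-digraph if it has $n$ vertices, every vertex has in-degree and out-degree $d$, and $\lambda(G)\le\lambda$. *)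

(* Defs.v *)
From mathcomp Require Import all_boot all_order all_algebra.
From mathcomp Require Import complex.
From mathcomp Require Import reals exp.

Set Implicit Arguments.
Unset Strict Implicit.
Unset Printing Implicit Defensive.

Import Order.TTheory GRing.Theory Num.Theory.
Local Open Scope ring_scope.

Section Digraph.
Variables (R : realType) (T : finType) (e : rel T).

Definition adjacency_mx : 'M[R[i]]_#|T| :=
  \matrix_(i, j) (e (enum_val i) (enum_val j))%:R.

(* The complex eigenvalues, listed with algebraic multiplicity. *)
Definition digraph_eigenvalues : seq R[i] :=
  sval (closed_field_poly_normal (char_poly adjacency_mx)).

(* [ComplexField.Normc.normc] is the modulus with values in R.  The maximum
   over an empty family is 0. *)
Definition digraph_lambda (d : nat) : R :=
  \big[Num.max/0]_(z <- digraph_eigenvalues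
                   | ComplexField.Normc.normc z != d%:R)
    ComplexField.Normc.normc z.

Definition is_ndl_digraph (n d : nat) (lambda : R) : Prop :=
  [/\ #|T| = n,
      forall x, #|[set y | e x y]| = d,
      forall x, #|[set y | e y x]| = d
    & digraph_lambda d <= lambda].

End Digraph.

Section SumProductDigraph.
Variable F : finFieldType.

Definition SL2 : finType := {A : 'M[F]_2 | \det A == 1}.

Definition G2_vertex : finType := (SL2 * 'M[F]_2)%type.

Definition G2 : rel G2_vertex :=
  fun u v => val u.1 *m val v.1 == u.2 + v.2.

End SumProductDigraph.

(* Main.v *)
Require Import Defs.
From mathcomp Require Import all_boot all_order all_algebra.
From mathcomp Require Import complex.
From mathcomp Require Import reals exp.
From mathcomp Require Import ring zify.

(* Let f be a left eigenvector for z, so that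
   sum_A f(A, AB - D) = z f(B, D), and suppose z is neither 0 nor |SL2|.  Summing
   over D and then over B shows that every fibre f_A = f(A, _) has sum 0.
   Expanding the squared norm of the left-hand side gives
     |z|^2 ||f||^2 = sum_{A, A'} <f_A, T_{A' - A} f_{A'}>,
   where T_X g (C) = sum_{B in SL2} g(C + XB).  If X is singular, the trivial
   bound ||T_X|| <= |SL2| = O(q^3) suffices, because only O(q^2) matrices A' in
   SL2 make A' - A singular.  If X is invertible, ||T_X g||^2 is the sum over Y
   of r(Y) times the autocorrelation of g at XY, where r(Y) is the number of B in
   SL2 with B + Y in SL2.  The autocorrelations sum to 0 and are at most ||g||^2,
   while r(Y) = q^2 + O(q) for Y <> 0 and r(0) = O(q^3); hence
   ||T_X g||^2 = O(q^5) ||g||^2.  Altogether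
   |z|^2 = O(q^3 q^(5/2) + q^2 q^3) = O(q^(11/2)). *)

Set Implicit Arguments.
Unset Strict Implicit.
Unset Printing Implicit Defensive.

Import Order.TTheory GRing.Theory Num.Theory.
Local Open Scope ring_scope.

(** * Points of [SL2] on affine hyperplanes of the matrix space *)

Section Counting.
Variable F : finFieldType.
Local Notation q := #|F|.

Lemma sum_mx2 (G : F -> F -> F -> F -> nat) :
  (\sum_(B : 'M[F]_2) (G (B 0 0) (B 0 1) (B 1 0) (B 1 1))%R =
   \sum_a \sum_b \sum_c \sum_d G a b c d)%N.
Proof.
rewrite pair_big /= pair_big /= pair_big /=.
pose h (t : F * F * F * F) : 'M[F]_2 :=
  \matrix_(i, j) if i == 0 then if j == 0 then t.1.1.1 else t.1.1.2
                 else if j == 0 then t.1.2 else t.2.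
rewrite (reindex h) /=; first by apply: eq_bigr => t _; rewrite !mxE.
exists (fun B : 'M[F]_2 => (B 0 0, B 0 1, B 1 0, B 1 1)).
  by move=> [[[a b] c] d] _; rewrite !mxE.
move=> B _; apply/matrixP => i j; rewrite !mxE /=.
by case: i => [[|[]]] // ?; case: j => [[|[]]] // ?;
  congr (B _ _); apply/val_inj.
Qed.

Lemma det_mx2 (B : 'M[F]_2) : \det B = B 0 0 * B 1 1 - B 0 1 * B 1 0.
Proof.
rewrite (expand_det_row _ 0) !big_ord_recl big_ord0 /cofactor !det_mx11 !mxE /=.
have -> : lift 0 0 = 1 :> 'I_2 by apply/val_inj.
have -> : lift 1 0 = 0 :> 'I_2 by apply/val_inj.
by rewrite /= expr0 expr1; ring.
Qed.

Lemma sum_nat_unique (P : pred F) (x : F) :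
  (forall y, P y = (y == x)) -> (\sum_y (P y : nat) = 1)%N.
Proof.
move=> Px; under eq_bigr do rewrite Px.
by rewrite (bigD1 x) //= eqxx big1 // => y /negPf ->.
Qed.

(** The points of [SL2] on an affine hyperplane, in coordinates: a nested sum of indicators lets
    each entry be substituted or eliminated separately. *)
Definition sl2_plane (x y z w k : F) : nat :=
  (\sum_a \sum_b \sum_c \sum_d
     ((a * d - b * c == 1) && (x * a + y * b + z * c + w * d == k) : nat)%R)%N.

Lemma sum_hyperbola (p : F) :
  (\sum_b \sum_c (b * c == p)%R = q.-1 + q * (p == 0)%R)%N.
Proof.
rewrite (bigD1 0) //=.
under [X in (X + _)%N]eq_bigr do rewrite mul0r eq_sym.
rewrite sum_nat_const addnC; congr (_ + _)%N.
under eq_bigr => b b0.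
  rewrite (@sum_nat_unique _ (b^-1 * p)); first over.
  by move=> c; apply: can2_eq; [apply: mulKf | apply: mulVKf].
by rewrite sum1_card cardC1.
Qed.

(** Eliminating [a] leaves, for each [d], a hyperbola with parameter [p.[d]]. It has [q.-1] points,
    and [q] more when [d] is a root of [p], so [n] counts the roots of a quadratic. *)
Lemma sl2_plane_normal y z w k : exists n,
  (n <= 2)%N /\ sl2_plane 1 y z w k = (q * q.-1 + q * n)%N.
Proof.
pose p : {poly F} := (y * z - w) *: 'X^2 + k *: 'X - 1.
exists (\sum_d (root p d))%N; split.
  (* The constant coefficient is [-1] whatever the other two are. *)
  have p0 : p != 0.
    apply/eqP => /(congr1 (fun r : {poly F} => r.[0])).
    by rewrite !hornerE /=; move/eqP; rewrite ?expr0n ?mulr0 ?add0r ?oppr_eq0 ?oner_eq0.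
  have sp : (size p <= 3)%N.
    rewrite /p -addrA (leq_trans (size_polyD _ _)) // geq_max.
    rewrite (leq_trans (size_scale_leq _ _)) ?size_polyXn //=.
    rewrite (leq_trans (size_polyD _ _)) // geq_max size_polyN size_poly1 andbT.
    by rewrite (leq_trans (size_scale_leq _ _)) ?size_polyX.
  have -> : (\sum_d root p d)%N = #|root p|.
    rewrite -sum1_card [RHS]big_mkcond; apply: eq_bigr => d _.
    by rewrite -topredE /=; case: (root p d).
  rewrite cardE -ltnS (leq_trans _ sp) //.
  apply: max_poly_roots => //; last by rewrite enum_uniq.
  by apply/allP => d; rewrite mem_enum.
have -> : (q * q.-1 + q * \sum_d root p d)%N =
          (\sum_d (q.-1 + q * (p.[d] == 0)%R))%N.
  by rewrite big_split /= sum_nat_const big_distrr /=.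
under [RHS]eq_bigr do rewrite -sum_hyperbola.
rewrite /sl2_plane exchange_big /=.
under eq_bigr do rewrite exchange_big /=.
under eq_bigr => b _ do under eq_bigr => c _ do rewrite exchange_big /=.
under eq_bigr do rewrite exchange_big /=.
rewrite exchange_big /=; apply: eq_bigr => d _.
(* With a eliminated, b' = b + z d and c' = c + y d turn the determinant
   equation into b' c' = p(d). *)
rewrite (reindex_inj (addIr (- (z * d)))) /=; apply: eq_bigr => b _.
rewrite (reindex_inj (addIr (- (y * d)))) /=; apply: eq_bigr => c _.
set b' := b - _; set c' := c - _.
pose a0 := k - y * b' - z * c' - w * d.
rewrite (bigD1 a0) //= big1 ?addn0 => [|a aa0].
  congr nat_of_bool; rewrite /p !hornerE.
  have -> : a0 + y * b' + z * c' + w * d == k.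
    by apply/eqP; rewrite /a0; ring.
  rewrite andbT -subr_eq0 -[RHS]subr_eq0 -[RHS]oppr_eq0; congr (_ == _).
  by rewrite /a0 /b' /c' /=; ring.
case: (X in _ && X) / eqP => [e|]; last by rewrite andbF.
by case/eqP: aa0; rewrite /a0 -e; ring.
Qed.

Lemma sl2_plane_scale x y z w k : x != 0 ->
  sl2_plane x y z w k = sl2_plane 1 (y / x) (z / x) (w / x) (k / x).
Proof.
move=> x0; rewrite /sl2_plane; do 4!apply: eq_bigr => ? _.
case: (_ == 1) => //=; congr nat_of_bool.
rewrite -(inj_eq (mulfI (invr_neq0 x0))) [x^-1 * k]mulrC; congr (_ == _).
by field.
Qed.

(** Exchanging two columns with one sign change preserves the determinant; this brings [y] to the
    first place, up to sign. *)
Lemma sl2_plane_swap_cols x y z w k :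
  sl2_plane x y z w k = sl2_plane (- y) x (- w) z k.
Proof.
rewrite /sl2_plane exchange_big [RHS](reindex_inj oppr_inj) /=.
apply: eq_bigr => b _; apply: eq_bigr => a _.
rewrite exchange_big [RHS](reindex_inj oppr_inj) /=.
apply: eq_bigr => d _; apply: eq_bigr => c _.
by congr nat_of_bool; congr (_ && _); congr (_ == _); ring.
Qed.

Lemma sl2_plane_swap_rows x y z w k :
  sl2_plane x y z w k = sl2_plane (- z) (- w) x y k.
Proof.
rewrite /sl2_plane.
under eq_bigr do rewrite exchange_big /=.
rewrite exchange_big [RHS](reindex_inj oppr_inj) /=; apply: eq_bigr => c _.
under eq_bigr do rewrite exchange_big /=.
rewrite exchange_big [RHS](reindex_inj oppr_inj) /=; apply: eq_bigr => d _.
apply: eq_bigr => a _; apply: eq_bigr => b _.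
by congr nat_of_bool; congr (_ && _); congr (_ == _); ring.
Qed.

(** Signed swaps of rows and columns bring a nonzero coefficient to the first place, where it is
    scaled to 1. *)
Lemma sl2_planeE x y z w k : [|| x != 0, y != 0, z != 0 | w != 0] ->
  exists2 n, (n <= 2)%N & sl2_plane x y z w k = (q * q.-1 + q * n)%N.
Proof.
wlog x0 : x y z w / x != 0 => [hw|_]; last first.
  by have [n [n2 e]] := sl2_plane_normal (y / x) (z / x) (w / x) (k / x);
    exists n => //; rewrite sl2_plane_scale.
have [->|y0] := eqVneq y 0; last first.
  by move=> _; rewrite sl2_plane_swap_cols; apply: hw; rewrite oppr_eq0 y0.
have [->|z0] := eqVneq z 0; last first.
  by move=> _; rewrite sl2_plane_swap_rows; apply: hw; rewrite oppr_eq0 z0.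
have [->|w0] := eqVneq w 0; last first.
  move=> _; rewrite sl2_plane_swap_cols sl2_plane_swap_rows.
  by apply: hw; rewrite opprK w0.
by rewrite !orbF => x0; apply: hw; rewrite x0.
Qed.

(* As det B = 1, the equation det (B + Y) = k is linear in B: its linear part is
   the polarisation of det at Y. *)
Lemma card_SL2_translate (Y : 'M[F]_2) (k : F) : Y != 0 ->
  exists2 n, (n <= 2)%N &
    #|[pred B : SL2 F | \det (val B + Y) == k]| = (q * q.-1 + q * n)%N.
Proof.
move=> Y0; set m := k - 1 - \det Y.
have [|n n2 e] := @sl2_planeE (Y 1 1) (- Y 1 0) (- Y 0 1) (Y 0 0) m.
  apply: contraR Y0; rewrite !negb_or !negbK !oppr_eq0.
  case/and4P => /eqP e11 /eqP e10 /eqP e01 /eqP e00.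
  apply/eqP/matrixP => i j; rewrite !mxE.
  by case: i => [[|[]]] // ?; case: j => [[|[]]] // ?;
     [rewrite -[RHS]e00|rewrite -[RHS]e01|rewrite -[RHS]e10|rewrite -[RHS]e11];
     congr (Y _ _); apply/val_inj.
exists n => //; rewrite -{}e -sum1_card.
rewrite -(big_sub_cond (fun A : 'M[F]_2 => \det A == 1)
  (fun B : 'M[F]_2 => \det (B + Y) == k) (fun=> 1%N)).
rewrite big_mkcond /sl2_plane -(sum_mx2 (fun a b c d =>
  (a * d - b * c == 1) && (Y 1 1 * a + - Y 1 0 * b + - Y 0 1 * c + Y 0 0 * d == m)
  : nat)).
apply: eq_bigr => B _; rewrite -det_mx2 unfold_in -mulnb /=.
case: eqP => //= detB; rewrite mul1n.
have -> : (\det (B + Y) == k) = (Y 1 1 * B 0 0 + - Y 1 0 * B 0 1 +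
    - Y 0 1 * B 1 0 + Y 0 0 * B 1 1 == m).
  rewrite -subr_eq0 -[RHS]subr_eq0; congr (_ == _).
  by rewrite /m -detB !det_mx2 !mxE; ring.
by case: (_ == _).
Qed.

(** Splitting [SL2] by the value of [\det (B + 1)] gives [q] classes, each of at most [q ^ 2 + q]
    elements. *)
Lemma card_SL2_le : (#|SL2 F| <= 2 * q ^ 3)%N.
Proof.
have q0 : (0 < q)%N by apply/card_gt0P; exists 0.
have -> : #|SL2 F| = (\sum_k #|[pred B : SL2 F | \det (val B + 1%:M) == k]|)%N.
  rewrite -sum1_card (partition_big (fun B : SL2 F => \det (val B + 1%:M)) predT) //=.
  by apply: eq_bigr => k _; rewrite -sum1_card.
apply: (@leq_trans (\sum_(k : F) 2 * q ^ 2)%N); last first.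
  by rewrite sum_nat_const mulnCA -expnS.
apply: leq_sum => k _; have [|n n2 ->] := @card_SL2_translate 1%:M k; last first.
    by rewrite -mulnn; nia.
by apply/eqP => /matrixP/(_ 0 0)/eqP; rewrite !mxE oner_eq0.
Qed.

End Counting.

Lemma natr_dist_le (R : numDomainType) (m n k : nat) :
  (m <= n + k)%N -> (n <= m + k)%N -> `|m%:R - n%:R| <= k%:R :> R.
Proof.
move=> mn nm; rewrite real_ler_distl ?rpredB ?realn //.
by rewrite lerBlDr -!natrD !ler_nat nm mn.
Qed.

(** * Norms and autocorrelations on a finite abelian group *)

Section Correlation.
Variables (K : numClosedFieldType) (V : finZmodType).
Implicit Types u v g : V -> K.

Definition norm2 g : K := \sum_x `|g x| ^+ 2.

Lemma norm2_ge0 g : 0 <= norm2 g.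
Proof. by apply: sumr_ge0 => x _; rewrite exprn_ge0. Qed.

Lemma norm2_shift g y : norm2 (fun x => g (x + y)) = norm2 g.
Proof. by rewrite /norm2 [RHS](reindex_inj (addIr y)). Qed.

Lemma weighted_AGM (k x y : K) : 0 < k -> 0 <= x -> 0 <= y ->
  (x * y) *+ 2 <= k * x ^+ 2 + k^-1 * y ^+ 2.
Proof.
move=> k0 x0 y0; rewrite -subr_ge0.
have -> : k * x ^+ 2 + k^-1 * y ^+ 2 - x * y *+ 2 = k^-1 * (k * x - y) ^+ 2.
  by field; rewrite gt_eqF.
rewrite mulr_ge0 ?invr_ge0 ?(ltW k0) // real_exprn_even_ge0 //.
by rewrite rpredB ?ger0_real // mulr_ge0 ?(ltW k0).
Qed.

(** A weighted substitute for Cauchy-Schwarz: with [k] an operator norm bound, no square roots of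
    norms appear. *)
Lemma inner_le k u v : 0 < k ->
  `|\sum_x u x * (v x)^*| *+ 2 <= k * norm2 u + k^-1 * norm2 v.
Proof.
move=> k0; apply: (@le_trans _ _ ((\sum_x `|u x * (v x)^*|) *+ 2)).
  by rewrite lerMn2r ler_norm_sum orbT.
rewrite -sumrMnl !mulr_sumr -big_split /=; apply: ler_sum => x _.
by rewrite normrM norm_conjC weighted_AGM.
Qed.

Definition autocorr g y := \sum_x g x * (g (x + y))^*.

Lemma autocorr_le g y : `|autocorr g y| <= norm2 g.
Proof.
have := @inner_le 1 g (fun x => g (x + y)) ltr01.
by rewrite norm2_shift invr1 mul1r -mulr2n lerMn2r.
Qed.

(** The double sum factors as the squared modulus of the sum of [g]. *)
Lemma sum_autocorr g : \sum_x g x = 0 -> \sum_y autocorr g y = 0.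
Proof.
move=> g0; rewrite exchange_big big1 //= => x _.
rewrite -mulr_sumr -rmorph_sum /=.
have -> : \sum_y g (x + y) = 0 by rewrite -[RHS]g0 [RHS](reindex_inj (addrI x)).
by rewrite rmorph0 mulr0.
Qed.

Lemma norm2_sum (I : finType) (h : I -> V) g :
  norm2 (fun x => \sum_i g (x + h i)) =
  \sum_i \sum_j autocorr g (h j - h i).
Proof.
under [LHS]eq_bigr => x _.
  rewrite normCK rmorph_sum big_distrlr /=; over.
rewrite exchange_big; apply: eq_bigr => i _.
rewrite exchange_big; apply: eq_bigr => j _.
rewrite (reindex_inj (addIr (- h i))) /=; apply: eq_bigr => x _.
by rewrite addrNK -addrA [- _ + _]addrC.
Qed.

End Correlation.

(** * Sums over [SL2] as operators, and the eigenvalue bound *)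

Section SL2Average.
Variables (K : numClosedFieldType) (F : finFieldType).
Local Notation q := #|F|.
Local Notation V := 'M[F]_2.
Implicit Types g : V -> K.

Definition sl2_sum (X : V) g (C : V) : K := \sum_(B : SL2 F) g (C + X *m val B).

Lemma norm2_sl2_sum_trivial X g :
  norm2 (sl2_sum X g) <= (2 * q ^ 3)%:R ^+ 2 * norm2 g.
Proof.
rewrite -[leLHS]ger0_norm ?norm2_ge0 // norm2_sum.
apply: (@le_trans _ _ (\sum_(B : SL2 F) \sum_(B' : SL2 F) norm2 g)).
  rewrite (le_trans (ler_norm_sum _ _ _)) //; apply: ler_sum => B _.
  rewrite (le_trans (ler_norm_sum _ _ _)) //; apply: ler_sum => B' _.
  exact: autocorr_le.
rewrite !sumr_const -mulrnA -[leLHS]mulr_natl ler_wpM2r ?norm2_ge0 //.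
by rewrite -natrX ler_nat -mulnn leq_mul ?card_SL2_le.
Qed.

Lemma norm2_sl2_sum_unit X g : \det X != 0 -> \sum_C g C = 0 ->
  norm2 (sl2_sum X g) <= 3 * q%:R ^+ 5 * norm2 g.
Proof.
move=> X0 g0; rewrite -[leLHS]ger0_norm ?norm2_ge0 // norm2_sum.
have Xu : X \in unitmx by rewrite unitmxE unitfE.
(* [r Y] counts the pairs in [SL2] with difference [Y], which groups the terms of the double sum. *)
pose r Y := #|[pred B : SL2 F | \det (val B + Y) == 1]|.
have -> : \sum_(B : SL2 F) \sum_(B' : SL2 F)
    autocorr g (X *m val B' - X *m val B) =
    \sum_Y (r Y)%:R * autocorr g (X *m Y).
  under eq_bigr => B _.
    rewrite -(big_sub (fun A : V => \det A == 1)
       (fun A => autocorr g (X *m A - X *m val B))) /=.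
    rewrite (reindex_inj (addrI (val B))) /= big_mkcond /=; over.
  rewrite exchange_big; apply: eq_bigr => Y _ /=.
  rewrite -big_mkcond /= /r -sum1_card natr_sum mulr_suml.
  apply: eq_big => [B|B _]; first by rewrite unfold_in.
  by rewrite mul1r -mulmxBr addrC addKr.
have sX : \sum_Y autocorr g (X *m Y) = 0.
  rewrite -[RHS](sum_autocorr g0) [RHS](reindex_inj (h := mulmx X)) //.
  exact: can_inj (mulKmx Xu).
(* The main term [q ^ 2] of [r] can be subtracted because the autocorrelations sum to 0. *)
have -> : \sum_Y (r Y)%:R * autocorr g (X *m Y) =
    \sum_Y ((r Y)%:R - (q ^ 2)%:R) * autocorr g (X *m Y).
  under [RHS]eq_bigr do rewrite mulrBl.
  by rewrite sumrB -mulr_sumr sX mulr0 subr0.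
have dist Y : Y != 0 -> `|(r Y)%:R - (q ^ 2)%:R : K| <= q%:R.
  move=> Y0; have [n n2 rY] := card_SL2_translate 1 Y0.
  by apply: natr_dist_le; rewrite /r rY -mulnn; nia.
have dist0 : `|(r 0)%:R - (q ^ 2)%:R : K| <= (2 * q ^ 3)%:R.
  have q0 : (0 < q)%N by apply/card_gt0P; exists 0.
  have r0 : (r 0%R <= 2 * q ^ 3)%N.
    exact: leq_trans (max_card _) (card_SL2_le F).
  have q23 : (q ^ 2 <= 2 * q ^ 3)%N.
    by rewrite (leq_trans (leq_pexp2l q0 (leqnSn 2))) // leq_pmull.
  by apply: natr_dist_le; lia.
apply: (@le_trans _ _ ((\sum_Y `|(r Y)%:R - (q ^ 2)%:R|) * norm2 g)).
  rewrite (le_trans (ler_norm_sum _ _ _)) // mulr_suml; apply: ler_sum => Y _.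
  by rewrite normrM ler_wpM2l ?autocorr_le.
rewrite ler_wpM2r ?norm2_ge0 // (bigD1 0) //=.
(* The term [Y = 0] costs [2 * q ^ 3], and the [q ^ 4] matrices cost at most [q] each, for a total
   of at most [3 * q ^ 5]. *)
apply: (@le_trans _ _ ((2 * q ^ 3)%:R + \sum_(Y : V) q%:R)).
  rewrite lerD // [leRHS](bigD1 0) //= ler_wpDl //; exact: ler_sum.
rewrite sumr_const card_mx -natrX -natrM -mulrnA -natrD ler_nat -expnS.
have q0 : (0 < q)%N by apply/card_gt0P; exists 0.
have : (q ^ 3 * 1 <= q ^ 3 * q ^ 2)%N by rewrite leq_mul2l expn_gt0 q0 orbT.
by rewrite -expnD muln1 /=; lia.
Qed.

(** Powers of [s] express half-integral powers of [q]. *)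
Local Notation s := (sqrtC q%:R : K).

(* An upper bound for the operator norm of [sl2_sum X] on functions of sum 0. *)
Definition sl2_gain (X : V) : K :=
  if \det X == 0 then (2 * q ^ 3)%:R else 2 * s ^+ 5.

Let q_gt0 : 0 < q%:R :> K.
Proof. by rewrite ltr0n; apply/card_gt0P; exists 0. Qed.

Let s_ge1 : 1 <= s.
Proof.
rewrite -[leLHS]sqrtC1 ler_sqrtC ?qualifE /= ?ler01 ?(ltW q_gt0) //.
by rewrite ler1n -(ltr0n K).
Qed.

Let s_gt0 : 0 < s.
Proof. exact: lt_le_trans ltr01 s_ge1. Qed.

Lemma sl2_gain_gt0 X : 0 < sl2_gain X.
Proof.
rewrite /sl2_gain natrM natrX.
by case: ifP => _; rewrite mulr_gt0 ?exprn_gt0 ?ltr0Sn.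
Qed.

Lemma norm2_sl2_sum X g : \sum_C g C = 0 ->
  norm2 (sl2_sum X g) <= sl2_gain X ^+ 2 * norm2 g.
Proof.
move=> g0; rewrite /sl2_gain; case: eqP => [_|/eqP X0].
  exact: norm2_sl2_sum_trivial.
rewrite (le_trans (norm2_sl2_sum_unit X0 g0)) // ler_wpM2r ?norm2_ge0 //.
rewrite exprMn exprAC sqrtCK ler_wpM2r ?exprn_ge0 ?(ltW q_gt0) //.
by rewrite -natrX ler_nat.
Qed.

Lemma sl2_form_le X u g : \sum_C g C = 0 ->
  `|\sum_C u C * (sl2_sum X g C)^*| *+ 2 <=
  sl2_gain X * (norm2 u + norm2 g).
Proof.
move=> g0; have k0 := sl2_gain_gt0 X.
rewrite (le_trans (inner_le _ _ k0)) // mulrDr lerD2l.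
by rewrite ler_pdivrMl // mulrA -expr2 norm2_sl2_sum.
Qed.

Lemma sl2_gainN X : sl2_gain (- X) = sl2_gain X.
Proof. by rewrite /sl2_gain -scaleN1r detZ sqrrN expr1n mul1r. Qed.

(** By [card_SL2_translate] at [- A] and 0, at most [2 * q ^ 2] differences are singular,
    contributing [4 * s ^+ 10]; the others contribute [4 * s ^+ 11], and [s] is at least 1. *)
Lemma sum_sl2_gain (A : SL2 F) :
  \sum_(B : SL2 F) sl2_gain (val B - val A) <= 8 * s ^+ 11.
Proof.
have A0 : - val A != 0.
  rewrite oppr_eq0; apply: contraTneq (valP A) => ->.
  by rewrite det0 eq_sym oner_eq0.
rewrite (bigID (fun B : SL2 F => \det (val B - val A) == 0)) /=.
apply: (@le_trans _ _ ((2 * q ^ 2)%:R * (2 * q ^ 3)%:R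
                      + (2 * q ^ 3)%:R * (2 * s ^+ 5))).
  apply: lerD.
    rewrite (eq_bigr (fun=> (2 * q ^ 3)%:R)) => [|B /eqP B0]; last first.
      by rewrite /sl2_gain B0 eqxx.
    rewrite sumr_const -[leLHS]mulr_natl ler_wpM2r ?ler0n // ler_nat.
    have [n n2] := card_SL2_translate 0 A0; rewrite -mulnn => e.
    by rewrite [leqLHS]e; have := q_gt0; rewrite ltr0n; nia.
  rewrite (eq_bigr (fun=> 2 * s ^+ 5)) => [|B /negPf B0]; last first.
    by rewrite /sl2_gain B0.
  rewrite sumr_const -[leLHS]mulr_natl ler_wpM2r //.
    by rewrite mulr_ge0 ?exprn_ge0 ?ltW ?ltr0n.
  by rewrite ler_nat (leq_trans (max_card _)) ?card_SL2_le.
have -> : (2 * q ^ 2)%:R * (2 * q ^ 3)%:R + (2 * q ^ 3)%:R * (2 * s ^+ 5)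
   = 4 * s ^+ 10 + 4 * s ^+ 11.
  have : q%:R = s ^+ 2 by rewrite sqrtCK.
  by set t := sqrtC _ => qE; rewrite !natrM ?natrX qE; ring.
rewrite (_ : 8 * s ^+ 11 = 4 * s ^+ 11 + 4 * s ^+ 11); last by ring.
by rewrite lerD2r ler_wpM2l // ler_weXn2l.
Qed.



(** Summing over [D] shows that [z] times each fibre sum is the total [T]. Summing this over [B]
    gives [z * T = #|SL2 F| * T], so [T] vanishes, and then so does each fibre sum. *)
Lemma shifted_eigenfunction_sum0 (f : SL2 F -> V -> K) (z : K) :
  (forall B D, \sum_A f A (val A *m val B - D) = z * f B D) ->
  z != 0 -> z != #|SL2 F|%:R -> forall B, \sum_D f B D = 0.
Proof.
move=> fz z0 zd B; pose T := \sum_A \sum_D f A D.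
have TE B' : T = z * \sum_D f B' D.
  rewrite mulr_sumr -(eq_bigr _ (fun D _ => fz B' D)) exchange_big /=.
  apply: eq_bigr => A _; rewrite (reindex_inj (addrI (val A *m val B'))) /=.
  by rewrite (reindex_inj oppr_inj).
have /eqP : (z - #|SL2 F|%:R) * T = 0.
  apply/eqP; rewrite mulrBl subr_eq0 {1}/T mulr_sumr; apply/eqP.
  rewrite -(eq_bigr _ (fun B' _ => TE B')) sumr_const.
  by rewrite mulr_natl.
rewrite mulf_eq0 subr_eq0 (negPf zd) (TE B) mulf_eq0 (negPf z0) /=.
by move/eqP.
Qed.

Lemma shifted_eigenvalue_le (f : SL2 F -> V -> K) (z : K) :
  (forall B D, \sum_A f A (val A *m val B - D) = z * f B D) ->
  (exists A C, f A C != 0) -> z != #|SL2 F|%:R ->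
  `|z| ^+ 2 <= 8 * s ^+ 11.
Proof.
move=> fz [A0 [C0 f0]] zd.
have [->|z0] := eqVneq z 0.
  by rewrite normr0 expr0n /= mulr_ge0 ?exprn_ge0 ?(ltW s_gt0).
have fs0 := shifted_eigenfunction_sum0 fz z0 zd.
pose N := \sum_A norm2 (f A).
have N0 : 0 < N.
  rewrite /N (bigD1 A0) //= ltr_wpDr ?sumr_ge0 // => [A _|].
    exact: norm2_ge0.
  rewrite /norm2 (bigD1 C0) //= ltr_wpDr ?sumr_ge0 ?exprn_gt0 ?normr_gt0 //.
  by move=> C _; rewrite exprn_ge0.
have zN : `|z| ^+ 2 * N =
    \sum_A \sum_A' \sum_C f A C * (sl2_sum (val A' - val A) (f A') C)^*.
  rewrite mulr_sumr.
  under eq_bigr => B _.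
    rewrite mulr_sumr.
    under eq_bigr => D _ do
      rewrite -exprMn -normrM -fz normCK rmorph_sum big_distrlr /=.
    rewrite exchange_big /=.
    under eq_bigr => A _ do rewrite exchange_big /=.
    over.
  rewrite exchange_big; apply: eq_bigr => A _ /=.
  rewrite exchange_big; apply: eq_bigr => A' _ /=.
  under [RHS]eq_bigr do rewrite rmorph_sum mulr_sumr.
  rewrite [RHS]exchange_big; apply: eq_bigr => B _ /=.
  (* With [D = A B - C], the arguments become [C] and [C + (A' - A) B]. *)
  rewrite (reindex_inj (addrI (val A *m val B))) (reindex_inj oppr_inj) /=.
  apply: eq_bigr => C _; congr (f A _ * (f A' _)^*).
    by rewrite opprD opprK addrA subrr add0r.
  by rewrite mulmxBl opprD opprK addrA addrC.
(* Multiplying by [N] and doubling matches the form of [sl2_form_le]. *)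
rewrite -(ler_pM2r N0) -(ler_pMn2r (isT : (0 < 2)%N)) zN.
rewrite -[leLHS]ger0_norm; last first.
  by rewrite mulrn_wge0 // -zN mulr_ge0 ?exprn_ge0 ?(ltW N0).
rewrite normrMn.
apply: (@le_trans _ _ (\sum_(A : SL2 F) \sum_(A' : SL2 F)
   sl2_gain (val A' - val A) * (norm2 (f A) + norm2 (f A')))).
  apply: (@le_trans _ _ ((\sum_(A : SL2 F) \sum_(A' : SL2 F)
    `|\sum_C f A C * (sl2_sum (val A' - val A) (f A') C)^*|) *+ 2)).
    rewrite lerMn2r /= (le_trans (ler_norm_sum _ _ _)) //.
    by apply: ler_sum => A _; exact: ler_norm_sum.
  rewrite -sumrMnl; apply: ler_sum => A _.
  by rewrite -sumrMnl; apply: ler_sum => A' _; apply: sl2_form_le.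
(* As the gain is even, exchanging [A] and [A'] identifies the two halves. *)
have -> : \sum_(A : SL2 F) \sum_(A' : SL2 F)
      sl2_gain (val A' - val A) * (norm2 (f A) + norm2 (f A')) =
    (\sum_(A : SL2 F) (\sum_(A' : SL2 F) sl2_gain (val A' - val A))
       * norm2 (f A)) *+ 2.
  under eq_bigr => A _.
    under eq_bigr => A' _ do rewrite mulrDr.
    rewrite big_split /=; over.
  rewrite big_split mulr2n /=; congr (_ + _).
    by apply: eq_bigr => A _; rewrite mulr_suml.
  rewrite exchange_big /=; apply: eq_bigr => A _; rewrite mulr_suml.
  by apply: eq_bigr => A' _; rewrite -sl2_gainN opprB.
rewrite lerMn2r /= mulr_sumr; apply: ler_sum => A _.
by rewrite ler_wpM2r ?norm2_ge0 ?sum_sl2_gain.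
Qed.

(** Squaring removes [s], so the bound transfers from [R[i]] to [R]. *)
Corollary shifted_eigenvalue_exp4_le (f : SL2 F -> V -> K) (z : K) :
  (forall B D, \sum_A f A (val A *m val B - D) = z * f B D) ->
  (exists A C, f A C != 0) -> z != #|SL2 F|%:R ->
  `|z| ^+ 4 <= 64 * q%:R ^+ 11.
Proof.
move=> fz f0 zd; have zle := shifted_eigenvalue_le fz f0 zd.
have -> : 64 * q%:R ^+ 11 = (8 * s ^+ 11) ^+ 2.
  by rewrite exprMn [in RHS]exprAC sqrtCK -(natrX _ 8 2).
by rewrite (exprM _ 2 2) lerXn2r ?nnegrE ?mulr_ge0 ?exprn_ge0 ?(ltW s_gt0).
Qed.

End SL2Average.

(** * Regularity of the digraph *)

Lemma card_G2_out (F : finFieldType) (x : G2_vertex F) :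
  #|[set y | G2 x y]| = #|SL2 F|.
Proof.
case: x => A C.
have inj_h : injective (fun B : SL2 F => (B, val A *m val B - C) : G2_vertex F).
  by move=> B B' [].
rewrite -[RHS](card_imset predT inj_h); apply: eq_card => -[B D].
rewrite inE /G2 /=; apply/eqP/imsetP => [e|[B' _ [-> ->]]].
  by exists B; rewrite // e addrC addKr.
by rewrite addrC subrK.
Qed.

Lemma card_G2_in (F : finFieldType) (x : G2_vertex F) :
  #|[set y | G2 y x]| = #|SL2 F|.
Proof.
case: x => B D.
have inj_h : injective (fun A : SL2 F => (A, val A *m val B - D) : G2_vertex F).
  by move=> A A' [].
rewrite -[RHS](card_imset predT inj_h); apply: eq_card => -[A C].
rewrite inE /G2 /=; apply/eqP/imsetP => [e|[A' _ [-> ->]]].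
  by exists A; rewrite // e addrK.
by rewrite subrK.
Qed.

(** * Adjacency eigenvalues and the spectral bound *)

Section Eigenvalues.
Variables (R : realType).
Local Notation normc := ComplexField.Normc.normc.

Lemma normcE (z : R[i]) : (normc z)%:C%C = `|z|.
Proof. by []. Qed.

(** A root of the characteristic polynomial has a row eigenvector, hence the sum over in-neighbours;
    [f] is that vector indexed by vertices. *)
Lemma digraph_eigenvalueP (T : finType) (e : rel T) (z : R[i]) :
  z \in digraph_eigenvalues R e ->
  exists2 f : T -> R[i], exists x, f x != 0 &
    forall y, \sum_x f x * (e x y)%:R = z * f y.
Proof.
rewrite /digraph_eigenvalues; case: closed_field_poly_normal => r /= pE zr.
have /eigenvalueP [v vz v0] : eigenvalue (adjacency_mx R e) z.
  by rewrite eigenvalue_root_char pE rootZ ?root_prod_XsubC //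
             (monicP (char_poly_monic _)) oner_neq0.
exists (fun x => v 0 (enum_rank x)).
  have [i vi] := rV0Pn _ v0.
  by exists (enum_val i); rewrite enum_valK.
move=> y; have := congr1 (fun w : 'rV_#|T| => w 0 (enum_rank y)) vz.
rewrite !mxE => <-; rewrite (reindex enum_rank) /=; last first.
  by apply: onW_bij; exact: enum_rank_bij.
by apply: eq_bigr => x _; rewrite !mxE !enum_rankK.
Qed.

Lemma G2_eigenvalue_le (F : finFieldType) (z : R[i]) :
  z \in digraph_eigenvalues R (@G2 F) -> normc z != #|SL2 F|%:R ->
  normc z ^+ 4 <= 64 * #|F|%:R ^+ 11.
Proof.
move=> /digraph_eigenvalueP [f [[A0 C0] f0] fz] zd.
have zd' : z != #|SL2 F|%:R.
  apply: contra zd => /eqP ->.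
  by rewrite -(inj_eq (@complexI R)) normcE normr_nat rmorph_nat.
(* For each [A], the only in-neighbour of [(B, D)] over [A] is [(A, A B - D)]. *)
have fz' (B : SL2 F) (D : 'M[F]_2) :
    \sum_A f (A, val A *m val B - D) = z * f (B, D).
  rewrite -fz (eq_bigr (fun p => f (p.1, p.2) * (G2 (p.1, p.2) (B, D))%:R)).
    rewrite -(pair_bigA _ (fun A C => f (A, C) * (G2 (A, C) (B, D))%:R)) /=.
    apply: eq_bigr => A _; rewrite (bigD1 (val A *m val B - D)) //= big1.
      by rewrite /G2 /= subrK eqxx mulr1 addr0.
    move=> C; rewrite /G2 /= eq_sym subr_eq => /negPf ->.
    by rewrite mulr0.
  by case.
have := @shifted_eigenvalue_exp4_le R[i] F (fun A C => f (A, C)) z fz'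
  (ex_intro _ A0 (ex_intro _ C0 f0)) zd'.
by rewrite -normcE -!(rmorph_nat (real_complex R)) -!rmorphXn -rmorphM lecR.
Qed.

End Eigenvalues.

Theorem theorem6p1 (R : realType) :
  exists2 c : R, 0 < c &
    forall F : finFieldType,
      is_ndl_digraph (@G2 F) (#|SL2 F| * #|{: 'M[F]_2}|)%N #|SL2 F|
        (c * #|F|%:R `^ (11 / 4)).
Proof.
(* The constant 3 works because fourth powers are compared below and [64 <= 3 ^ 4]. *)
exists 3 => // F; split; first exact: card_prod.
- exact: card_G2_out.
- exact: card_G2_in.
rewrite /digraph_lambda big_seq_cond; apply: bigmax_le => [|z /andP[zE zd]].
  (* The default value 0 of the maximum must also lie below the bound. *)
  by rewrite mulr_ge0 ?powR_ge0.
rewrite -(@ler_pXn2r _ 4) ?nnegrE ?mulr_ge0 ?powR_ge0 //; last first.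
  by rewrite -lecR normcE normr_ge0.
rewrite (le_trans (G2_eigenvalue_le zE zd)) // exprMn.
rewrite -(@powR_mulrn _ (_ `^ _)) ?powR_ge0 //.
rewrite -powRrM (_ : 11 / 4 * 4 = 11%:R); last by field.
rewrite powR_mulrn ?ler0n // ler_wpM2r ?exprn_ge0 ?ler0n //.
by rewrite -natrX ler_nat.
Qed.
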